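(* Let $\Delta=\operatorname{conv}\{0,\alpha(1),\dots,\alpha(n)\}\subset\mathbb{R}^n$ be an $n$-dimensional simplex with $\alpha(j)\in(2\mathbb{N})^n$ for all $j$, let $I=\{y(1),\dots,y(|I|)\}\subseteq\operatorname{int}(\Delta)\cap\mathbb{N}^n$, and for each $i$ let $\lambda_0^{(i)},\dots,\lambda_n^{(i)}$ be the coefficients of the unique convex combination $y(i)=\sum_{j=1}^n\lambda_j^{(i)}\alpha(j)$, $\sum_{j=0}^n\lambda_j^{(i)}=1$. Let $$f=\sum_{j=1}^{|I|}\lambda_0^{(j)}+\sum_{j=1}^n b_j\mathbf{x}^{\alpha(j)}-\sum_{y(i)\in I}a_i\mathbf{x}^{y(i)}$$ with all $a_i,b_j>0$ (so $\operatorname{New}(f)=\Delta$), of degree at most $2d$. Then $$f\in P_{n,2d}\quad\text{if and only if}\quad f=\sum_{i=1}^{|I|}E_{y(i)},$$ where each $E_{y(i)}\in P_{\Delta(i)}^{y(i)}$ is a nonnegative circuit polynomial whose support is contained in $\{0,\alpha(1),\dots,\alpha(n),y(i)\}$. If furthermore $I\subseteq\Delta^*$, then $$f\in P_{n,2d}\iff f\in\Sigma_{n,2d}\iff f\text{ is a sum of binomial squares}.$$ In particular, the latter equivalences always hold if $\Delta$ is an $H$-simplex.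
   Context: $\mathbb{N}=\{0,1,2,\dots\}$. $P_{n,2d}$ is the cone of polynomials in $\mathbb{R}[x_1,\dots,x_n]$ of degree at most $2d$ that are nonnegative on $\mathbb{R}^n$, and $\Sigma_{n,2d}$ is the cone of sums of squares of real polynomials of degree at most $d$. $\operatorname{New}(f)$ is the Newton polytope. For a simplex $\Delta'$ with vertex set contained in $(2\mathbb{N})^n$ and a lattice point $y$ in its interior, $P_{\Delta'}^y$ is the set of real polynomials consisting of one term with positive coefficient for each vertex of $\Delta'$ plus a term $c\,\mathbf{x}^y$ with $c\in\mathbb{R}\setminus\{0\}$; such polynomials are called circuit polynomials. In the claim $\Delta(i)$ denotes the Newton simplex of $E_{y(i)}$. Mediated sets: let $\hat\Delta=\{0,\alpha(1),\dots,\alpha(n)\}$ be the vertex set of $\Delta$. For $L\subseteq\Delta\cap\mathbb{Z}^n$ put $\overline{A}(L)=\{\tfrac12(s+t)\in\mathbb{Z}^n: s\ne t,\ s,t\in L\cap(2\mathbb{Z})^n\}$. $L$ is $\hat\Delta$-mediated if $\hat\Delta\subseteq L\subseteq\overline{A}(L)\cup\hat\Delta$. $\Delta^*$ denotes the (unique) maximal $\hat\Delta$-mediated set, which contains every $\hat\Delta$-mediated set. $\Delta$ is an $H$-simplex if $\Delta^*=\Delta\cap\mathbb{Z}^n$. A sum of binomial squares is a sum of squares of real polynomials each having at most two terms. *)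

(* Defs.v *)
From HB Require Import structures.
From mathcomp Require Import all_boot all_order all_algebra.
From mathcomp Require Import mpoly.
From mathcomp Require Import boolp classical_sets reals topology normedtype.

Set Implicit Arguments.
Unset Strict Implicit.
Unset Printing Implicit Defensive.

Import Order.TTheory GRing.Theory Num.Theory.
Import numFieldNormedType.Exports.

Local Open Scope classical_set_scope.
Local Open Scope ring_scope.

Section LatticeSimplices.
Variables (R : realType) (n : nat).

Definition mnm_point (u : 'X_{1..n}) : 'rV[R]_n := \row_i (u i)%:R.

Definition even_mnm (u : 'X_{1..n}) : Prop := forall i, ~~ odd (u i).

Section Vertices.
Variables (r : nat) (v : 'I_r.+1 -> 'X_{1..n}).

Definition affine_comb (c : 'I_r.+1 -> R) (x : 'rV[R]_n) : Prop :=
  \sum_j c j = 1 /\ x = \sum_j c j *: mnm_point (v j).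

Definition convex_comb (c : 'I_r.+1 -> R) (x : 'rV[R]_n) : Prop :=
  (forall j, 0 <= c j) /\ affine_comb c x.

Definition aff_hull : set 'rV[R]_n := [set x | exists c, affine_comb c x].

Definition conv_hull : set 'rV[R]_n := [set x | exists c, convex_comb c x].

(* With this hypothesis, [conv_hull] is an r-dimensional simplex with vertices v. *)
Definition affinely_independent : Prop :=
  forall c : 'I_r.+1 -> R,
    \sum_j c j = 0 -> \sum_j c j *: mnm_point (v j) = 0 -> forall j, c j = 0.

(* Interior of [conv_hull] inside its affine hull, since r may be less than n;
   for an n-dimensional simplex this is the topological interior. *)
Definition relative_interior : set 'rV[R]_n :=
  [set x | conv_hull x /\ within aff_hull (nbhs x) conv_hull].

(* Every simplex below lies in the nonnegative orthant, so the points of Z^n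
   it contains are exactly exponents of monomials. *)
Definition lattice_points : set 'X_{1..n} := [set u | conv_hull (mnm_point u)].

Definition even_midpoints (L : set 'X_{1..n}) : set 'X_{1..n} :=
  [set u | exists s t : 'X_{1..n}, [/\ s <> t, L s /\ even_mnm s,
             L t /\ even_mnm t & (u *+ 2 = s + t)%MM]].

Definition mediated (L : set 'X_{1..n}) : Prop :=
  [/\ L `<=` lattice_points, range v `<=` L
    & L `<=` even_midpoints L `|` range v].

Definition max_mediated : set 'X_{1..n} := \bigcup_(L in mediated) L.

Definition H_simplex : Prop := max_mediated = lattice_points.

Lemma vertex_lattice_points : range v `<=` lattice_points.
Proof.
move=> _ [j _ <-]; exists (fun k => (k == j)%:R); split=> [k|]; first exact: ler0n.
split; rewrite (bigD1 j) //= big1 ?addr0 ?eqxx ?scale1r //.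
- by move=> k /negbTE ->.
- by move=> k /negbTE ->; rewrite scale0r.
Qed.

Lemma max_mediated_mediated : mediated max_mediated.
Proof.
split.
- by move=> u [L [+ _ _] Lu]; apply.
- move=> u vu; exists (range v) => //.
  by split=> [||w vw]; [exact: vertex_lattice_points | | right].
- move=> u [L ML Lu]; have [_ _ LP] := ML.
  case: (LP u Lu) => [[s [t [st [Ls es] [Lt et] e]]]|vu]; last by right.
  by left; exists s, t; split=> //; split=> //; exists L.
Qed.

Lemma mediated_sub_max (L : set 'X_{1..n}) : mediated L -> L `<=` max_mediated.
Proof. by move=> ML u Lu; exists L. Qed.

(* P_Delta'^y, for Delta' the simplex with vertices v. *)
Definition circuit_poly (y : 'X_{1..n}) (p : {mpoly R[n]}) : Prop :=
  [/\ affinely_independent, forall j, even_mnm (v j),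
      relative_interior (mnm_point y)
    & exists (b : 'I_r.+1 -> R) (c : R),
        [/\ forall j, 0 < b j, c != 0
          & p = \sum_j b j *: 'X_[v j] + c *: 'X_[y]]].

End Vertices.

Definition nonneg_mpoly (p : {mpoly R[n]}) : Prop :=
  forall x : 'I_n -> R, 0 <= p.@[x].

(* [msize] is one more than the degree. *)
Definition P_cone (d : nat) : set {mpoly R[n]} :=
  [set p | (msize p <= (2 * d).+1)%N /\ nonneg_mpoly p].

Definition Sigma_cone (d : nat) : set {mpoly R[n]} :=
  [set p | exists2 qs : seq {mpoly R[n]},
     all (fun q => msize q <= d.+1)%N qs & p = \sum_(q <- qs) q ^+ 2].

Definition binomial_sos : set {mpoly R[n]} :=
  [set p | exists2 qs : seq {mpoly R[n]},
     all (fun q => size (msupp q) <= 2)%N qs & p = \sum_(q <- qs) q ^+ 2].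

End LatticeSimplices.

Arguments mnm_point R {n} u.
Arguments conv_hull R {n r} v.
Arguments aff_hull R {n r} v.
Arguments relative_interior R {n r} v.
Arguments affinely_independent R {n r} v.
Arguments lattice_points R {n r} v.
Arguments mediated R {n r} v L.
Arguments max_mediated R {n r} v.
Arguments H_simplex R {n r} v.

Definition with_origin n (alpha : 'I_n -> 'X_{1..n}) (k : 'I_n.+1) : 'X_{1..n} :=
  oapp alpha 0%MM (unlift ord0 k).

(* Main.v *)
Require Import Defs.
From HB Require Import structures.
From mathcomp Require Import all_boot all_order all_algebra.
From mathcomp Require Import mpoly.
From mathcomp Require Import boolp classical_sets reals topology normedtype.
From mathcomp Require Import sequences exp zify ring.
Import Order.TTheory GRing.Theory Num.Theory.
Import numFieldNormedType.Exports.
Local Open Scope classical_set_scope.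
Local Open Scope ring_scope.
Set Implicit Arguments.
Unset Strict Implicit.
Unset Printing Implicit Defensive.

(** The exponents y(i) are interior, so every barycentric coordinate is
    positive.  For l in R^n put g(u) = exp (- <l,u>) X^u, a monomial rescaled to
    take the value 1 at exp l, and let
      agiform(u) = sum_j c_j g(v_j) - g(u)
    where c are the barycentric coordinates of u.  Convexity of exp (weighted
    AM-GM) makes this polynomial nonnegative, and it vanishes at exp l.

    The key point is the choice of l: if exp l is a critical point of f in the
    positive orthant, then with A_i = a_i exp <l,y(i)> one gets
      f = f(exp l) + sum_i A_i agiform(y(i)).
    Indeed the vanishing of the gradient, written in the basis alpha(j), says
    b_j exp <l,alpha(j)> = sum_i A_i lambda_j^(i), which is the equality of the
    coefficients at alpha(j).  If f is nonnegative then so is f(exp l), and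
    sharing this constant equally among the summands yields the circuit
    polynomials ([agiform_decomposition], [circuit_poly_agiform]).  The
    critical equations are solved without calculus: in the coordinates
    <l,alpha(j)> they are a fixed point equation for a monotone map that, since
    sum_(j >= 1) lambda_j^(i) < 1, sends a large cube to itself
    ([critical_exponents]).

    If u is the midpoint of even points s, t then
      g(s) + g(t) - 2 g(u) = (g(s/2) - g(t/2))^2,
    so modulo sums of binomial squares g(u) is bounded by the average of g(s)
    and g(t).  In a mediated set all inner points can be eliminated from these
    bounds, one after the other ([midpoint_elimination]); what remains bounds
    g(u) by an average of the g(v_j) with barycenter u, and this says that
    agiform(u) is a sum of binomial squares ([agiform_binomial_squares]).
    Hence so is f whenever it is nonnegative and all y(i) lie in the maximal
    mediated set.  The squared binomials have exponents that are halves of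
    points of the simplex, which bounds their degree by d. *)

(** * Critical points *)

(** Knaster-Tarski: the supremum of the points below [hi] that increase under
    [F] is fixed. *)
Lemma monotone_fixpoint (R : realType) (I : Type) (F : (I -> R) -> I -> R)
    (lo hi : I -> R) :
  (forall u v, (forall i, u i <= v i) -> forall i, F u i <= F v i) ->
  (forall i, lo i <= F lo i) -> (forall i, F hi i <= hi i) ->
  (forall i, lo i <= hi i) ->
  exists u, forall i, F u i = u i.
Proof.
move=> F_mono lo_post hi_pre lo_hi.
pose P := [set u | (forall i, u i <= hi i) /\ forall i, u i <= F u i].
have Plo : P lo by [].
pose s i := sup [set u i | u in P].
have P_le_s u : P u -> forall i, u i <= s i.
  move=> Pu i; apply: ub_le_sup; last by exists u.
  by exists (hi i) => _ [w [w_hi _] <-].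
have s_le i z : (forall u, P u -> u i <= z) -> s i <= z.
  move=> uz; apply: ge_sup; first by exists (lo i), lo.
  by move=> _ [u Pu <-]; exact: uz.
have s_post i : s i <= F s i.
  apply: s_le => u Pu; have [_ u_post] := Pu.
  by apply: le_trans (u_post i) _; apply: F_mono; exact: P_le_s.
have Fs_P : P (F s).
  split=> i; last exact: F_mono.
  apply: le_trans (hi_pre i); apply: F_mono => k.
  by apply: s_le => u [u_hi _]; exact: u_hi.
exists s => i; apply: le_anti; rewrite s_post andbT.
exact: P_le_s.
Qed.

(** The equations say that the gradient of
      sum_j b_j exp (u_j) - sum_i a_i exp (<c_i,u>)
    vanishes at [u].  Taking logarithms makes them a fixed point equation for a
    map that is monotone because [a] and [c] are positive, and along the diagonal
    u = (z, ..., z) the right-hand side grows like exp (z sum_k c_ik), more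
    slowly than exp z, which provides the cube between [- M] and [M]. *)
Lemma critical_exponents (R : realType) (n m : nat) (b : 'I_n -> R)
    (a : 'I_m -> R) (c : 'I_m -> 'I_n -> R) :
  (0 < m)%N -> (forall j, 0 < b j) -> (forall i, 0 < a i) ->
  (forall i j, 0 < c i j) -> (forall i, \sum_j c i j < 1) ->
  exists u : 'I_n -> R, forall j,
    b j * expR (u j) = \sum_i a i * c i j * expR (\sum_k c i k * u k).
Proof.
move=> m_gt0 b_gt0 a_gt0 c_gt0 c_lt1.
pose S u j := \sum_i a i * c i j * expR (\sum_k c i k * u k).
have S_gt0 u j : 0 < S u j.
  rewrite /S (bigD1 (Ordinal m_gt0)) //= ltr_wpDr //.
    by apply: sumr_ge0 => i _; rewrite !mulr_ge0 ?expR_ge0 ?ltW.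
  by rewrite !mulr_gt0 ?expR_gt0.
suff [u uE] : exists u : 'I_n -> R, forall j, ln (S u j / b j) = u j.
  exists u => j; rewrite -[in LHS]uE lnK ?posrE ?divr_gt0 //.
  by rewrite mulrC divfK ?gt_eqF.
pose i0 := Ordinal m_gt0.
pose e i := 1 - \sum_j c i j.
have e_gt0 i : 0 < e i by rewrite subr_gt0.
(* [exp x >= x] turns the two cube conditions into lower bounds on [M]: [lowM]
   comes from the single term [i0] at [- M], [highM] from all terms at [M]. *)
pose lowM j := b j / (a i0 * c i0 j * e i0).
pose highM j := \sum_i a i * c i j / (e i * b j).
have low_ge0 j : 0 <= lowM j by rewrite divr_ge0 ?mulr_ge0 ?ltW.
have high_ge0 j : 0 <= highM j.
  by apply: sumr_ge0 => i _; rewrite divr_ge0 ?mulr_ge0 ?ltW.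
pose M := 1 + \sum_j (lowM j + highM j).
have M_ge j : lowM j + highM j <= M.
  rewrite /M (bigD1 j) //= addrCA lerDl addr_ge0 ?ler01 //.
  by apply: sumr_ge0 => k _; rewrite addr_ge0.
have M_gt0 : 0 < M.
  by rewrite ltr_pwDl ?ltr01 ?sumr_ge0 // => j _; rewrite addr_ge0.
apply: (@monotone_fixpoint _ _ _ (fun=> - M) (fun=> M)) => [u v uv j|j|j|j].
- rewrite ler_ln ?posrE ?divr_gt0 // ler_pM2r ?invr_gt0 // ler_sum // => i _.
  rewrite ler_pM2l ?mulr_gt0 // ler_expR ler_sum // => k _.
  by rewrite ler_pM2l.
- rewrite -ler_expR lnK ?posrE ?divr_gt0 // ler_pdivlMr // /S (bigD1 i0) //=.
  rewrite ler_wpDr //.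
    by apply: sumr_ge0 => i _; rewrite !mulr_ge0 ?expR_ge0 ?ltW.
  rewrite -mulr_suml; set sc := \sum_k _.
  have -> : sc * - M = M * e i0 + - M by rewrite /e -/sc; ring.
  rewrite expRD mulrA [expR (- M) * b j]mulrC ler_pM2r ?expR_gt0 //.
  have le_lM : lowM j <= M by apply: le_trans (M_ge j); rewrite lerDl.
  have -> : b j = a i0 * c i0 j * (lowM j * e i0).
    by rewrite /lowM; field; rewrite !gt_eqF.
  rewrite ler_pM2l ?mulr_gt0 //.
  apply: le_trans (expR_ge1Dx _); rewrite ler_wpDl ?ler01 //.
  by rewrite ler_pM2r.
- rewrite -ler_expR lnK ?posrE ?divr_gt0 // ler_pdivrMr // /S.
  have le_hM : highM j <= M by apply: le_trans (M_ge j); rewrite lerDr.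
  apply: le_trans (_ : \sum_i a i * c i j * (expR M / (M * e i)) <= _).
    apply: ler_sum => i _; rewrite ler_pM2l ?mulr_gt0 // -mulr_suml.
    set sc := \sum_k _.
    have -> : sc * M = M + - (M * e i) by rewrite /e -/sc; ring.
    rewrite expRD expRN ler_pM2l ?expR_gt0 //.
    rewrite lef_pV2 ?posrE ?expR_gt0 ?mulr_gt0 //.
    by apply: le_trans (expR_ge1Dx _); rewrite ler_wpDl ?ler01.
  have -> : \sum_i a i * c i j * (expR M / (M * e i)) =
            expR M * (highM j * b j / M).
    rewrite /highM !mulr_suml mulr_sumr; apply: eq_bigr => i _.
    by field; rewrite !gt_eqF.
  rewrite ler_pM2l ?expR_gt0 // ler_pdivrMr // [b j * _]mulrC ler_pM2r //.
- by rewrite -subr_ge0 opprK addr_ge0 // ltW.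
Qed.

(** * Barycentric coordinates *)

Section Simplices.
Variables (R : realType) (n r : nat) (v : 'I_r.+1 -> 'X_{1..n}).

Lemma affine_comb_inj (c c' : 'I_r.+1 -> R) (x : 'rV[R]_n) :
  affinely_independent R v ->
  affine_comb v c x -> affine_comb v c' x -> c =1 c'.
Proof.
move=> v_indep [c1 xc] [c'1 xc'] j; apply/eqP; rewrite -subr_eq0; apply/eqP.
apply: (v_indep (fun j => c j - c' j)); first by rewrite sumrB c1 c'1 subrr.
by under eq_bigr do rewrite scalerBl; rewrite sumrB -xc -xc' subrr.
Qed.

Lemma affine_comb_vertex j :
  affine_comb v (fun k => (k == j)%:R : R) (mnm_point R (v j)).
Proof.
split; rewrite (bigD1 j) //= big1 ?addr0 ?eqxx ?scale1r //.
- by move=> k /negbTE ->.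
- by move=> k /negbTE ->; rewrite scale0r.
Qed.

Lemma vertex_inj : affinely_independent R v -> injective v.
Proof.
move=> v_indep j k vjk; have := affine_comb_vertex j; rewrite vjk => vj.
have /(_ k) := affine_comb_inj v_indep vj (affine_comb_vertex k).
rewrite eqxx; case: eqVneq => [-> //|_] /eqP.
by rewrite eq_sym oner_eq0.
Qed.

(** An interior point can be pushed slightly further away from a vertex
    without leaving the simplex; if its coordinate at that vertex were zero, the
    coordinate would become negative. *)
Lemma interior_comb_gt0 (c : 'I_r.+1 -> R) (x : 'rV[R]_n) :
  affinely_independent R v -> interior (conv_hull R v) x ->
  convex_comb v c x -> forall j, 0 < c j.
Proof.
move=> v_indep x_int [c_ge0 [c1 xc]] j.
pose h (t : R) := x + t *: (x - mnm_point R (v j)).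
have h_cvg : h t @[t --> 0] --> x.
  have <- : h 0 = x by rewrite /h scale0r addr0.
  apply: cvgD; first exact: cvg_cst.
  by apply: cvgZr_tmp; exact: cvg_id.
have [t t_gt0 [c' [c'_ge0 c'P]]] : exists2 t, 0 < t & conv_hull R v (h t).
  have /nbhs_ballP[e /= e_gt0 he] := h_cvg _ x_int.
  exists (e / 2); first by rewrite divr_gt0.
  apply: he; rewrite /ball /= sub0r normrN gtr0_norm ?divr_gt0 //.
  by rewrite ltr_pdivrMr // mulr_natr mulr2n ltrDl.
(* The coordinates of the pushed point, by uniqueness, must agree with [c']. *)
have /affine_comb_inj/(_ c'P) : affine_comb v
    (fun k => (1 + t) * c k - t * (k == j)%:R) (h t).
  have [d1 dj] := affine_comb_vertex j.
  split; first by rewrite sumrB -!mulr_sumr d1 c1 !mulr1 addrK.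
  rewrite /h {1 2}xc [in LHS]dj.
  under [RHS]eq_bigr do rewrite scalerBl -!scalerA.
  by rewrite sumrB -!scaler_sumr scalerBr scalerDl scale1r addrA.
move=> /(_ v_indep j) c'E.
have := c'_ge0 j; rewrite -c'E eqxx mulr1 subr_ge0 => /(lt_le_trans t_gt0).
by rewrite pmulr_rgt0 // addr_gt0.
Qed.

End Simplices.

(** * Agiforms *)

(** Averaging the tangent line bounds [exp w_j >= exp W (1 + w_j - W)] at the
    barycenter [W]. *)
Lemma expR_jensen (R : realType) (J : finType) (c w : J -> R) :
  (forall j, 0 <= c j) -> \sum_j c j = 1 ->
  expR (\sum_j c j * w j) <= \sum_j c j * expR (w j).
Proof.
move=> c_ge0 c1; set W := \sum_j c j * w j.
have -> : expR W = \sum_j c j * (expR W * (1 + (w j - W))).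
  under eq_bigr do rewrite mulrCA.
  rewrite -mulr_sumr.
  under eq_bigr do rewrite mulrDr mulr1 mulrBr.
  by rewrite big_split /= c1 sumrB -mulr_suml c1 mul1r subrr addr0 mulr1.
apply: ler_sum => j _; rewrite ler_wpM2l //.
rewrite -[w j in leRHS](subrK W) [w j - W + W]addrC expRD.
by rewrite ler_pM2l ?expR_gt0 ?expR_ge1Dx.
Qed.

Section Agiforms.
Variables (R : realType) (n : nat).
Implicit Types (l x : 'I_n -> R) (s t u : 'X_{1..n}).

Definition pairing l u : R := \sum_k l k * (u k)%:R.

Lemma pairing0 l : pairing l 0%MM = 0.
Proof. by rewrite /pairing big1 // => k _; rewrite mnm0E mulr0. Qed.

Lemma pairingD l s t : pairing l (s + t)%MM = pairing l s + pairing l t.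
Proof.
rewrite /pairing -big_split /=; apply: eq_bigr => k _.
by rewrite mnmDE natrD mulrDr.
Qed.

Lemma pairing_subl l l' u :
  pairing (fun k => l k - l' k) u = pairing l u - pairing l' u.
Proof. by rewrite /pairing -sumrB; apply: eq_bigr => k _; rewrite mulrBl. Qed.

Lemma pairing_affine_comb l r (v : 'I_r.+1 -> 'X_{1..n}) c u :
  affine_comb v c (mnm_point R u) ->
  pairing l u = \sum_j c j * pairing l (v j).
Proof.
move=> [_ uE]; under eq_bigr do rewrite mulr_sumr.
rewrite exchange_big; apply: eq_bigr => k _ /=.
have := congr1 (fun p : 'rV_n => p ord0 k) uE.
rewrite !mxE summxE => ->; rewrite mulr_sumr; apply: eq_bigr => j _.
by rewrite !mxE mulrCA.
Qed.

Lemma mnm_point_inj : injective (@mnm_point R n).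
Proof.
move=> s t /rowP st; apply/mnmP => k; have := st k; rewrite !mxE => /eqP.
by rewrite eqr_nat => /eqP.
Qed.

Lemma meval_expR l u : ('X_[u]).@[fun k => expR (l k)] = expR (pairing l u).
Proof.
rewrite mevalX expR_sum; apply: eq_bigr => k _.
by rewrite [_ * (u k)%:R]mulrC expRM_natl.
Qed.

(** Since [ln 0 = 0], a vanishing variable may be treated as if it were 1 as
    long as it does not occur in the monomial. *)
Lemma norm_mevalX x u : (forall k, x k = 0 -> u k = 0%N) ->
  `|('X_[u]).@[x]| = expR (pairing (fun k => ln `|x k|) u).
Proof.
move=> xu; rewrite mevalX normr_prod expR_sum; apply: eq_bigr => k _.
rewrite normrX [_ * (u k)%:R]mulrC expRM_natl.
have [x0|xN0] := eqVneq (x k) 0; first by rewrite (xu _ x0) !expr0.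
by rewrite lnK // posrE normr_gt0.
Qed.

Lemma meval_even_ge0 x u : even_mnm u -> 0 <= ('X_[u]).@[x].
Proof.
by move=> u_even; rewrite mevalX prodr_ge0 // => k _; rewrite exprn_even_ge0.
Qed.

Definition rescaled l u : {mpoly R[n]} := expR (- pairing l u) *: 'X_[u].

(** Reznick's arithmetic-geometric forms, dehomogenized and rescaled to
    vanish at [exp l] when [c] gives the barycentric coordinates of [u]. *)
Definition agiform l r (v : 'I_r.+1 -> 'X_{1..n}) (c : 'I_r.+1 -> R) u :=
  \sum_j c j *: rescaled l (v j) - rescaled l u.

Lemma meval_agiform l r (v : 'I_r.+1 -> 'X_{1..n}) c u x :
  (agiform l v c u).@[x] =
    \sum_j c j * (expR (- pairing l (v j)) * ('X_[v j]).@[x])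
    - expR (- pairing l u) * ('X_[u]).@[x].
Proof.
rewrite /agiform mevalB (big_morph _ (mevalD x) (meval0 x)) !mevalZ.
by congr (_ - _); apply: eq_bigr => j _; rewrite !mevalZ.
Qed.

(** In the coordinates [ln `|x|] this is Jensen's inequality for exp.  If a
    variable of [u] vanishes at [x], only the nonnegative vertex terms remain;
    otherwise a vanishing variable occurs neither in [u] nor, by positivity of
    [c], in any vertex. *)
Lemma agiform_nonneg l r (v : 'I_r.+1 -> 'X_{1..n}) c u :
  (forall j, even_mnm (v j)) -> (forall j, 0 < c j) ->
  affine_comb v c (mnm_point R u) -> nonneg_mpoly (agiform l v c u).
Proof.
move=> v_even c_gt0 uc x; rewrite meval_agiform subr_ge0.
have sum_ge0 : 0 <= \sum_j c j * (expR (- pairing l (v j)) * ('X_[v j]).@[x]).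
  by apply: sumr_ge0 => j _; rewrite !mulr_ge0 ?expR_ge0 ?meval_even_ge0 ?ltW.
have [/existsP[k /andP[/eqP xk uk]]|] :=
    boolP [exists k, (x k == 0) && (u k != 0%N)].
  rewrite [X in _ * X <= _]mevalX (bigD1 k) //= xk expr0n (negbTE uk).
  by rewrite mul0r mulr0.
rewrite negb_exists => /forallP xu.
have u0 k : x k = 0 -> u k = 0%N.
  by move=> xk; have := xu k; rewrite xk eqxx /= negbK => /eqP.
have v0 j k : x k = 0 -> v j k = 0%N.
  move=> /u0 uk.
  (* Coordinate [k] of the barycentric identity, read as a pairing. *)
  have := pairing_affine_comb (fun i => (i == k)%:R) uc.
  have pk (s : 'X_{1..n}) : pairing (fun i => (i == k)%:R) s = (s k)%:R.
    rewrite /pairing (bigD1 k) //= eqxx mul1r big1 ?addr0 // => i /negbTE ->.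
    by rewrite mul0r.
  rewrite pk uk; under eq_bigr do rewrite pk.
  move/esym/eqP; rewrite psumr_eq0 => [|i _]; last by rewrite mulr_ge0 ?ler0n ?ltW.
  move/allP/(_ j (mem_index_enum _)); rewrite mulf_eq0 gt_eqF //=.
  by rewrite pnatr_eq0 => /eqP.
pose w k := ln `|x k| - l k.
have e_norm s : (forall k, x k = 0 -> s k = 0%N) ->
    expR (- pairing l s) * `|('X_[s]).@[x]| = expR (pairing w s).
  by move=> /norm_mevalX ->; rewrite -expRD pairing_subl addrC.
apply: le_trans (_ : expR (pairing w u) <= _).
  by rewrite -e_norm // ler_wpM2l ?expR_ge0 ?ler_norm.
rewrite (pairing_affine_comb w uc).
apply: le_trans (expR_jensen _ (fun j => ltW (c_gt0 j)) uc.1) _.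
apply: ler_sum => j _; rewrite -e_norm; last exact: v0.
by rewrite ger0_norm ?meval_even_ge0.
Qed.

End Agiforms.

(** * Elimination of inner points of a mediated set *)

(** Modulo the cone [C], the value at [u] is bounded by averages with barycenter
    [pt u] of values at other points.  Induction on [K] removes its points from
    the support of such averages: the midpoint bound for [w], after removing
    the tail of [K] from it, gives weights [q] with [q w < 1], so that [val w]
    can be solved for and substituted in the bound for [u].  Keeping track of
    barycenters is what guarantees [q w < 1]: otherwise both halves of the
    midpoint bound would be concentrated at [w], forcing [s = w = t]. *)
Lemma midpoint_elimination (R : realType) (T : finType) (W V : lmodType R)
    (pt : T -> W) (val : T -> V) (C : set V) (L : {set T}) (K : seq T) :
  injective pt -> C 0 ->
  (forall p q, C p -> C q -> C (p + q)) ->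
  (forall k p, 0 <= k -> C p -> C (k *: p)) ->
  (forall w, w \in K -> exists s t, [/\ s \in L, t \in L, s != t,
     pt w *+ 2 = pt s + pt t & C (val s + val t - val w *+ 2)]) ->
  forall u, u \in L -> exists p : T -> R,
    [/\ forall z, 0 <= p z, forall z, p z != 0 -> (z \in L) && (z \notin K),
        \sum_z p z = 1, \sum_z p z *: pt z = pt u
      & C (\sum_z p z *: val z - val u)].
Proof.
move=> pt_inj C0 CD CZ; elim: K => [|w K IH] mid u uL.
  exists (fun z => (z == u)%:R).
  have sum_at (X : lmodType R) (F : T -> X) : \sum_z (z == u)%:R *: F z = F u.
    rewrite (bigD1 u) //= eqxx scale1r big1 ?addr0 // => z /negbTE ->.
    by rewrite scale0r.
  split=> [z|z| | |]; rewrite ?ler0n ?sum_at ?subrr //.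
    by have [->|] := eqVneq z u; rewrite ?uL // eqxx.
  by under eq_bigr => z _ do rewrite -[_%:R]mulr1; exact: (sum_at R^o (fun=> 1)).
have {}IH := IH (fun z zK => mid z (@mem_behead _ (w :: K) z zK)).
have [s [t [sL tL st wE Cw]]] := mid w (mem_head _ _).
have [ps [ps0 psL ps1 psE Cs]] := IH s sL.
have [pt' [pt0 ptL pt1 ptE Ct]] := IH t tL.
have [pu [pu0 puL pu1 puE Cu]] := IH u uL.
pose q z := (ps z + pt' z) / 2.
have half_sum (X : lmodType R) (F : T -> X) :
    \sum_z q z *: F z = 2^-1 *: (\sum_z ps z *: F z + \sum_z pt' z *: F z).
  rewrite -big_split scaler_sumr; apply: eq_bigr => z _.
  by rewrite /= -scalerDl scalerA mulrC.
have half2 (X : lmodType R) (F : X) : 2^-1 *: (F *+ 2) = F.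
  by rewrite -[F *+ 2]scaler_nat scalerA mulVf ?scale1r // pnatr_eq0.
have q0 z : 0 <= q z by rewrite divr_ge0 ?addr_ge0.
have qL z : q z != 0 -> (z \in L) && (z \notin K).
  apply: contraR => zN; rewrite /q.
  have -> : ps z = 0 by apply/eqP; apply: contraR zN => /psL.
  have -> : pt' z = 0 by apply/eqP; apply: contraR zN => /ptL.
  by rewrite addr0 mul0r.
have q1 : \sum_z q z = 1.
  by rewrite -mulr_suml big_split /= ps1 pt1 -[1 + 1]/(2%:R) divff // pnatr_eq0.
have qE : \sum_z q z *: pt z = pt w.
  by rewrite half_sum psE ptE -wE half2.
have Cq : C (\sum_z q z *: val z - val w).
  rewrite half_sum.
  have -> : 2^-1 *: (\sum_z ps z *: val z + \sum_z pt' z *: val z) - val w =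
     2^-1 *: ((\sum_z ps z *: val z - val s) + (\sum_z pt' z *: val z - val t)
              + (val s + val t - val w *+ 2)).
    rewrite -[val w in LHS]half2 -scalerBr; congr (_ *: _).
    rewrite [RHS]addrA; congr (_ - _).
    by rewrite [_ - _ + (_ - _)]addrACA -opprD subrK.
  by apply: CZ; rewrite ?invr_ge0 ?ler0n //; apply: (CD) => //; exact: CD.
have qw_lt1 : q w < 1.
  have qw_le1 : q w <= 1.
    by rewrite -q1 (bigD1 w) //= lerDl sumr_ge0.
  rewrite lt_neqAle qw_le1 andbT; apply: contra st => /eqP qw1.
  have q_off z : z != w -> q z = 0.
    move: q1; rewrite (bigD1 w) //= qw1 => /eqP.
    rewrite -subr_eq0 addrAC subrr add0r psumr_eq0 // => /allP q_off zw.
    by have := q_off z (mem_index_enum _); rewrite zw => /eqP.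
  have p_off (p : T -> R) x : \sum_z p z = 1 -> \sum_z p z *: pt z = pt x ->
      (forall z, z != w -> p z = 0) -> x = w.
    move=> p1 pE p_off; apply: pt_inj; rewrite -pE (bigD1 w) //= big1 => [|z zw].
      move: p1; rewrite (bigD1 w) //= big1 => [|z zw]; last exact: p_off.
      by rewrite !addr0 => ->; rewrite scale1r.
    by rewrite p_off // scale0r.
  have sum0 z : z != w -> ps z = 0 /\ pt' z = 0.
    move=> /q_off/eqP; rewrite mulf_eq0 invr_eq0 pnatr_eq0 orbF.
    by rewrite paddr_eq0 // => /andP[/eqP ? /eqP ?].
  have -> := p_off ps s ps1 psE (fun z zw => (sum0 z zw).1).
  by have -> := p_off pt' t pt1 ptE (fun z zw => (sum0 z zw).2).
(* The weight of [u] at [w] is redistributed along [q]; the factor [k] sums the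
   geometric series of returns to [w]. *)
pose k := pu w / (1 - q w).
have k0 : 0 <= k by rewrite divr_ge0 // subr_ge0 ltW.
have kE : k * (1 - q w) = pu w by rewrite divfK // subr_eq0 eq_sym lt_eqF.
pose p z := pu z + k * (q z - (z == w)%:R).
have sum_p (X : lmodType R) (F : T -> X) :
    \sum_z p z *: F z =
    \sum_z pu z *: F z + k *: (\sum_z q z *: F z - F w).
  have -> : F w = \sum_z (z == w)%:R *: F z.
    rewrite (bigD1 w) //= eqxx scale1r big1 ?addr0 // => z /negbTE ->.
    by rewrite scale0r.
  rewrite -sumrB scaler_sumr -big_split; apply: eq_bigr => z _ /=.
  by rewrite -scalerBl scalerA -scalerDl.
have pw : p w = 0.
  by rewrite /p eqxx -kE /=; ring.
exists p; split=> [z|z| | |].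
- have [->|zw] := eqVneq z w; first by rewrite pw lexx.
  by rewrite /p (negbTE zw) subr0 addr_ge0 ?(mulr_ge0 k0 (q0 z)).
- have [->|zw] := eqVneq z w; first by rewrite pw eqxx.
  rewrite inE negb_or zw /= /p (negbTE zw) subr0.
  have [-> | /puL //] := eqVneq (pu z) 0; rewrite add0r mulf_eq0 negb_or.
  by move=> /andP[_ /qL].
- have := sum_p R^o (fun=> 1).
  under eq_bigr => z _ do rewrite [_ *: _]mulr1.
  under [X in _ = X + _]eq_bigr => z _ do rewrite [_ *: _]mulr1.
  under [X in _ = _ + _ *: (X - _)]eq_bigr => z _ do rewrite [_ *: _]mulr1.
  by rewrite pu1 q1 subrr scaler0 addr0.
- by rewrite sum_p puE qE subrr scaler0 addr0.
- rewrite sum_p addrAC; apply: (CD) => //; exact: CZ.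
Qed.

(** * Sums of binomial squares *)

Section BinomialSquares.
Variables (R : realType) (n : nat).

(** Combining both restrictions on the summands lets one certificate serve for
    [Sigma_cone d] and for [binomial_sos]. *)
Definition binomial_squares (d : nat) : set {mpoly R[n]} :=
  [set p | exists2 qs : seq {mpoly R[n]},
     all (fun q => (size (msupp q) <= 2)%N && (msize q <= d.+1)%N) qs
     & p = \sum_(q <- qs) q ^+ 2].

Lemma binomial_squares_sqr d (q : {mpoly R[n]}) :
  (size (msupp q) <= 2)%N -> (msize q <= d.+1)%N -> binomial_squares d (q ^+ 2).
Proof. by move=> q2 qd; exists [:: q]; rewrite ?big_seq1 //= q2 qd. Qed.

Lemma binomial_squares0 d : binomial_squares d 0.
Proof. by exists [::]; rewrite ?big_nil. Qed.

Lemma binomial_squaresD d p q :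
  binomial_squares d p -> binomial_squares d q -> binomial_squares d (p + q).
Proof.
move=> [ps psd ->] [qs qsd ->]; exists (ps ++ qs); first by rewrite all_cat psd.
by rewrite big_cat.
Qed.

Lemma binomial_squaresZ d (k : R) p :
  0 <= k -> binomial_squares d p -> binomial_squares d (k *: p).
Proof.
move=> k0 [ps /allP psd ->]; exists [seq Num.sqrt k *: q | q <- ps].
  rewrite all_map; apply/allP => q /psd /andP[q2 qd] /=.
  rewrite (leq_trans (msizeZ_le _ _) qd) andbT; apply: leq_trans q2.
  by apply: uniq_leq_size (msupp_uniq _) _; exact: msuppZ_le.
rewrite big_map scaler_sumr; apply: eq_bigr => q _.
by rewrite exprZn sqr_sqrtr.
Qed.

Lemma binomial_squares_sum d (I : finType) (F : I -> {mpoly R[n]}) :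
  (forall i, binomial_squares d (F i)) -> binomial_squares d (\sum_i F i).
Proof.
move=> FB; elim/big_ind: _ => //; first exact: binomial_squares0.
exact: binomial_squaresD.
Qed.

Lemma binomial_squares_Sigma d p : binomial_squares d p -> Sigma_cone d p.
Proof.
by move=> [qs qsd ->]; exists qs => //; apply: sub_all qsd => q /andP[].
Qed.

Lemma binomial_squares_sos d p : binomial_squares d p -> binomial_sos p.
Proof.
by move=> [qs qsd ->]; exists qs => //; apply: sub_all qsd => q /andP[].
Qed.

Lemma sum_sqr_nonneg (qs : seq {mpoly R[n]}) :
  nonneg_mpoly (\sum_(q <- qs) q ^+ 2).
Proof.
move=> x; rewrite (big_morph _ (mevalD x) (meval0 x)).
by apply: sumr_ge0 => q _; rewrite rmorphXn sqr_ge0.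
Qed.

End BinomialSquares.

Section Mediated.
Variables (R : realType) (n : nat).

Definition half_mnm (u : 'X_{1..n}) : 'X_{1..n} := [multinom (u k)./2 | k < n].

Lemma half_mnmK u : even_mnm u -> (half_mnm u + half_mnm u)%MM = u.
Proof.
move=> u_even; apply/mnmP => k; rewrite mnmDE mnmE addnn.
by rewrite -[RHS]odd_double_half (negbTE (u_even k)).
Qed.

Lemma rescaledD (l : 'I_n -> R) s t :
  rescaled l (s + t)%MM = rescaled l s * rescaled l t.
Proof.
by rewrite /rescaled pairingD opprD expRD mpolyXD -scalerAl -scalerAr scalerA.
Qed.

(** The expression is the square of the difference of the rescaled monomials of
    exponents [s / 2] and [t / 2]. *)
Lemma midpoint_binomial_square (l : 'I_n -> R) d u s t :
  even_mnm s -> even_mnm t -> (u *+ 2 = s + t)%MM ->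
  (mdeg s <= 2 * d)%N -> (mdeg t <= 2 * d)%N ->
  binomial_squares d (rescaled l s + rescaled l t - rescaled l u *+ 2).
Proof.
move=> s_even t_even uE s_deg t_deg.
set s' := half_mnm s; set t' := half_mnm t.
have sE : (s' + s')%MM = s := half_mnmK s_even.
have tE : (t' + t')%MM = t := half_mnmK t_even.
have -> : u = (s' + t')%MM.
  apply/mnmP => k; have /mnmP/(_ k) := uE; rewrite -sE -tE !(mulmnE, mnmDE).
  lia.
have -> : rescaled l s + rescaled l t - rescaled l (s' + t')%MM *+ 2 =
          (rescaled l s' - rescaled l t') ^+ 2.
  by rewrite -sE -tE !rescaledD; ring.
have half_deg w : (mdeg (w + w)%MM <= 2 * d)%N -> (mdeg w <= d)%N.
  by rewrite mdegD; lia.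
have supp w : msupp (rescaled l w) = [:: w].
  by rewrite msuppMCX // gt_eqF ?expR_gt0.
have sub : {subset msupp (rescaled l s' - rescaled l t') <= [:: s'; t']}.
  by move=> w /msuppB_le; rewrite !supp.
apply: binomial_squares_sqr.
  exact: (uniq_leq_size (msupp_uniq _) sub).
rewrite msizeE; apply/bigmax_leqP_seq => w /sub + _.
rewrite !inE => /orP[] /eqP ->; rewrite ltnS half_deg ?sE ?tE //.
Qed.

Variables (r : nat) (v : 'I_r.+1 -> 'X_{1..n}).

Lemma mdeg_lattice_point D u :
  (forall j, (mdeg (v j) <= D)%N) -> lattice_points R v u -> (mdeg u <= D)%N.
Proof.
move=> v_deg [c [c_ge0 uc]]; rewrite -(ler_nat R).
have deg_pairing (w : 'X_{1..n}) : (mdeg w)%:R = pairing (fun=> 1 : R) w.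
  by rewrite mdegE natr_sum; apply: eq_bigr => k _; rewrite mul1r.
rewrite deg_pairing (pairing_affine_comb _ uc).
apply: le_trans (_ : \sum_j c j * D%:R <= _); last first.
  by rewrite -mulr_suml uc.1 mul1r.
by apply: ler_sum => j _; rewrite -deg_pairing ler_wpM2l // ler_nat.
Qed.

(** All inner points of the maximal mediated set are eliminated; the remaining
    weights sit on the vertices and have barycenter [u], so they are the
    barycentric coordinates.  The degree bound makes the set finite. *)
Lemma agiform_binomial_squares (l : 'I_n -> R) d c u :
  affinely_independent R v -> (forall j, (mdeg (v j) <= 2 * d)%N) ->
  max_mediated R v u -> affine_comb v c (mnm_point R u) ->
  binomial_squares d (agiform l v c u).
Proof.
move=> v_indep v_deg u_med uc.
have [med_lattice v_med med_mid] := max_mediated_mediated R v.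
have med_deg s : max_mediated R v s -> (mdeg s < (2 * d).+1)%N.
  by move=> /med_lattice; exact: mdeg_lattice_point.
pose T := 'X_{1..n < (2 * d).+1}.
pose L : {set T} := finset (fun z : T => `[< max_mediated R v z >]).
have inL (z : T) : reflect (max_mediated R v z) (z \in L).
  by rewrite inE; exact: asboolP.
pose K := [seq z <- enum {: T} | (z \in L) && (val z \notin codom v)].
pose vT j : T := BMultinom (med_deg _ (v_med _ (ex_intro2 _ _ j I erefl))).
pose uT : T := BMultinom (med_deg _ u_med).
have uL : uT \in L by apply/inL.
have pt_inj : injective (fun z : T => mnm_point R z).
  by move=> z1 z2 /mnm_point_inj /val_inj.
have mid w : w \in K -> exists s t : T, [/\ s \in L, t \in L, s != t,
    mnm_point R w *+ 2 = mnm_point R s + mnm_point R t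
    & binomial_squares d (rescaled l s + rescaled l t - rescaled l w *+ 2)].
  rewrite mem_filter => /andP[/andP[/inL w_med w_v] _].
  case: (med_mid _ w_med) => [|[j _ vj]]; last first.
    by case/negP: w_v; rewrite -[val w]vj codom_f.
  move=> [s [t [st [s_med s_even] [t_med t_even] wE]]].
  exists (BMultinom (med_deg _ s_med)), (BMultinom (med_deg _ t_med)).
  split; [exact/inL | exact/inL | by apply/eqP => -[/st] | |].
  - apply/rowP => k; rewrite !mxE -!natrD /= -(mnmDE _ s) -wE mulmnE muln2.
    by rewrite addnn.
  - exact: (midpoint_binomial_square l s_even t_even wE
              (med_deg _ s_med) (med_deg _ t_med)).
have [p [p_ge0 p_supp p1 pE]] := midpoint_elimination pt_inj
  (@binomial_squares0 R n d) (@binomial_squaresD R n d)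
  (@binomial_squaresZ R n d) mid uL.
have vT_inj : injective vT.
  by move=> j k [] /(vertex_inj v_indep).
have p_sum (V : lmodType R) (F : 'X_{1..n} -> V) :
    \sum_z p z *: F (val z) = \sum_j p (vT j) *: F (v j).
  rewrite (bigID (fun z => z \in codom vT)) /= [X in _ + X]big1 ?addr0.
    have vT_uniq : uniq (codom vT) by exact/injectiveP.
    rewrite -big_uniq //=.
    by rewrite big_image.
  move=> z zv; have [-> | /p_supp] := eqVneq (p z) 0; first by rewrite scale0r.
  rewrite mem_filter mem_enum andbT => /andP[-> /=]; rewrite negbK.
  case/codomP => j zj; case/codomP: zv; exists j; exact: val_inj.
have pv : affine_comb v (p \o vT) (mnm_point R u).
  split; last by rewrite -pE (p_sum _ (mnm_point R)).
  have := p_sum R^o (fun=> 1).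
  under eq_bigr => z _ do rewrite [_ *: _]mulr1.
  under [RHS]eq_bigr => z _ do rewrite [_ *: _]mulr1.
  by rewrite p1.
have pc := affine_comb_inj v_indep pv uc.
rewrite (p_sum _ (rescaled l)); congr binomial_squares.
by congr (_ - _); apply: eq_bigr => j _; rewrite -pc.
Qed.

End Mediated.

(** * The decomposition *)

Section Decomposition.
Variables (R : realType) (n : nat).

Lemma prescribed_pairing (alpha : 'I_n -> 'X_{1..n}) (w : 'I_n -> R) :
  affinely_independent R (with_origin alpha) ->
  exists l : 'I_n -> R, forall j, pairing l (alpha j) = w j.
Proof.
move=> indep.
pose A : 'M[R]_n := \matrix_(j, k) (alpha j k)%:R.
have A_unit : A \in unitmx.
  rewrite -row_free_unit; apply: inj_row_free => x xA.
  (* A linear relation between the [alpha j] becomes an affine one by choosing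
     the weight of the origin. *)
  pose c (j : 'I_n.+1) := oapp (x ord0) (- \sum_k x ord0 k) (unlift ord0 j).
  have c0 : c ord0 = - \sum_k x ord0 k by rewrite /c unlift_none.
  have cS j : c (lift ord0 j) = x ord0 j by rewrite /c liftK.
  have cK : forall j, c j = 0.
    apply: indep; rewrite big_ord_recl.
      by under eq_bigr do rewrite cS; rewrite c0 addNr.
    have -> : mnm_point R (with_origin alpha ord0) = 0.
      by apply/rowP => k; rewrite !mxE /with_origin unlift_none mnm0E.
    rewrite scaler0 add0r -[RHS]xA; apply/rowP => k.
    rewrite !mxE summxE; apply: eq_bigr => j _.
    by rewrite cS !mxE /with_origin liftK.
  by apply/rowP => j; rewrite -cS cK mxE.
have [l lE] : exists l : 'cV[R]_n, A *m l = \col_j w j.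
  by exists (invmx A *m \col_j w j); rewrite mulKVmx.
exists (fun k => l k ord0) => j.
have := congr1 (fun p : 'cV_n => p j ord0) lE; rewrite !mxE => <-.
by apply: eq_bigr => k _; rewrite mxE mulrC.
Qed.

Lemma sum_with_origin (V : lmodType R) (alpha : 'I_n -> 'X_{1..n})
    (k : 'I_n.+1 -> R) (F : 'X_{1..n} -> V) :
  \sum_j k j *: F (with_origin alpha j) =
  k ord0 *: F 0%MM + \sum_j k (lift ord0 j) *: F (alpha j).
Proof.
rewrite big_ord_recl {1}/with_origin unlift_none; congr (_ + _).
by apply: eq_bigr => j _; rewrite /with_origin liftK.
Qed.

(** With [exp l] a critical point of [f], comparing the coefficients at
    [alpha j] is the critical equation, and the agiforms all vanish at [exp l],
    which identifies the constant that is left. *)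
Lemma agiform_decomposition (m : nat) (alpha : 'I_n -> 'X_{1..n})
    (y : 'I_m -> 'X_{1..n}) (lambda : 'I_m -> 'I_n.+1 -> R) (k0 : R)
    (b : 'I_n -> R) (a : 'I_m -> R) :
  affinely_independent R (with_origin alpha) -> (0 < m)%N ->
  (forall i j, 0 < lambda i j) ->
  (forall i, affine_comb (with_origin alpha) (lambda i) (mnm_point R (y i))) ->
  (forall j, 0 < b j) -> (forall i, 0 < a i) ->
  let f := k0%:MP + \sum_j b j *: 'X_[alpha j] - \sum_i a i *: 'X_[y i] in
  exists l : 'I_n -> R,
    f = (f.@[fun k => expR (l k)])%:MP
        + \sum_i (a i * expR (pairing l (y i))) *:
            agiform l (with_origin alpha) (lambda i) (y i).
Proof.
move=> indep m_gt0 lam_gt0 yE b_gt0 a_gt0 f.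
have [w wE] : exists w : 'I_n -> R, forall j, b j * expR (w j) =
    \sum_i a i * lambda i (lift ord0 j)
           * expR (\sum_k lambda i (lift ord0 k) * w k).
  apply: critical_exponents => // i; have [<- _] := yE i.
  by rewrite big_ord_recl ltrDr.
have [l lE] := prescribed_pairing w indep.
have l0 : pairing l (with_origin alpha ord0) = 0.
  by rewrite /with_origin unlift_none pairing0.
have lS j : pairing l (with_origin alpha (lift ord0 j)) = w j.
  by rewrite /with_origin liftK lE.
have ly i : pairing l (y i) = \sum_k lambda i (lift ord0 k) * w k.
  rewrite (pairing_affine_comb l (yE i)) big_ord_recl l0 mulr0 add0r.
  by apply: eq_bigr => k _; rewrite lS.
set A := fun i => a i * expR (pairing l (y i)).
have AE i : A i = a i * expR (pairing l (y i)) by [].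
have fE : f = (k0 - \sum_i A i * lambda i ord0)%:MP
    + \sum_i A i *: agiform l (with_origin alpha) (lambda i) (y i).
  have -> : \sum_i A i *: agiform l (with_origin alpha) (lambda i) (y i) =
      (\sum_i A i * lambda i ord0)%:MP + \sum_j b j *: 'X_[alpha j]
      - \sum_i a i *: 'X_[y i].
    under eq_bigr => i _ do
      rewrite /agiform sum_with_origin scalerBr scalerDr scalerA.
    rewrite sumrB big_split /=; congr (_ + _ - _).
    - rewrite -scaler_suml /rescaled pairing0 oppr0 expR0 scale1r mpolyX0.
      by rewrite -mul_mpolyC mulr1.
    - under eq_bigr => i _ do rewrite scaler_sumr.
      rewrite exchange_big; apply: eq_bigr => j _ /=.
      under eq_bigr => i _ do rewrite scalerA.
      rewrite -scaler_suml scalerA; congr (_ *: _).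
      have -> : \sum_i A i * lambda i (lift ord0 j) = b j * expR (w j).
        by rewrite wE; apply: eq_bigr => i _; rewrite AE ly mulrAC.
      by rewrite lE -mulrA -expRD subrr expR0 mulr1.
    - apply: eq_bigr => i _.
      by rewrite scalerA AE -mulrA -expRD subrr expR0 mulr1.
  by rewrite addrA addrA mpolyCB subrK.
exists l; rewrite {1}fE; congr (_%:MP + _).
rewrite fE mevalD mevalC (big_morph _ (mevalD _) (meval0 _)).
rewrite [X in _ = _ + X]big1 ?addr0 //.
move=> i _; rewrite mevalZ meval_agiform.
under eq_bigr => j _ do rewrite meval_expR -expRD addNr expR0 mulr1.
by rewrite (yE i).1 meval_expR -expRD addNr expR0 subrr mulr0.
Qed.

Lemma circuit_poly_agiform (alpha : 'I_n -> 'X_{1..n}) (l : 'I_n -> R)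
    (c : 'I_n.+1 -> R) (y : 'X_{1..n}) (g k : R) :
  affinely_independent R (with_origin alpha) ->
  (forall j, even_mnm (alpha j)) ->
  interior (conv_hull R (with_origin alpha)) (mnm_point R y) ->
  (forall j, 0 < c j) -> 0 <= g -> 0 < k ->
  circuit_poly (with_origin alpha) y
    (g%:MP + k *: agiform l (with_origin alpha) c y).
Proof.
move=> indep alpha_even y_int c_gt0 g_ge0 k_gt0; split=> //.
- move=> j; rewrite /with_origin; case: unlift => [i|] //=.
  by move=> i; rewrite mnm0E.
- split; first exact: interior_subset.
  by apply: filterS y_int => x.
exists (fun j => k * c j * expR (- pairing l (with_origin alpha j))
                 + g * (j == ord0)%:R), (- (k * expR (- pairing l y))); split.
- move=> j; rewrite ltr_pwDl ?mulr_ge0 ?ler0n //.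
  by rewrite !mulr_gt0 ?expR_gt0.
- by rewrite oppr_eq0 mulf_neq0 ?gt_eqF ?expR_gt0.
rewrite /agiform scalerBr scaler_sumr scaleNr -scalerA addrA; congr (_ - _).
under [RHS]eq_bigr do rewrite scalerDl -!scalerA.
rewrite big_split /= addrC; congr (_ + _).
rewrite -scaler_sumr (bigD1 ord0) //= scale1r big1 => [|j /negbTE ->].
  by rewrite addr0 /with_origin unlift_none mpolyX0 -mul_mpolyC mulr1.
by rewrite scale0r.
Qed.

Lemma msupp_circuit r (v : 'I_r.+1 -> 'X_{1..n}) y (p : {mpoly R[n]}) :
  circuit_poly v y p -> {subset msupp p <= y :: codom v}.
Proof.
move=> [_ _ _ [b [c [_ _ ->]]]] u.
rewrite mcoeff_msupp inE; apply: contraR; rewrite negb_or => /andP[uy uv].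
rewrite mcoeffD mcoeffZ mcoeffX [y == u]eq_sym (negbTE uy) mulr0 addr0.
rewrite (big_morph _ (mcoeffD u) (mcoeff0 _ u)) big1 // => j _.
rewrite mcoeffZ mcoeffX; case: eqVneq => [vj|_]; last by rewrite mulr0.
by rewrite -vj codom_f in uv.
Qed.

End Decomposition.

Theorem theorem5p5 (R : realType) (n d m : nat)
  (alpha : 'I_n -> 'X_{1..n}) (y : 'I_m -> 'X_{1..n})
  (lambda : 'I_m -> 'I_n.+1 -> R) (b : 'I_n -> R) (a : 'I_m -> R)
  (f : {mpoly R[n]})
  (Delta_dim : affinely_independent R (with_origin alpha))
  (alpha_even : forall j, even_mnm (alpha j))
  (m_gt0 : (0 < m)%N)
  (y_inj : injective y)
  (y_int : forall i, interior (conv_hull R (with_origin alpha)) (mnm_point R (y i)))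
  (lambdaP : forall i,
    convex_comb (with_origin alpha) (lambda i) (mnm_point R (y i)))
  (b_gt0 : forall j, 0 < b j)
  (a_gt0 : forall i, 0 < a i)
  (f_def : f = (\sum_i lambda i ord0)%:MP
             + \sum_j b j *: 'X_[alpha j] - \sum_i a i *: 'X_[y i])
  (f_deg : (msize f <= (2 * d).+1)%N) :
  (P_cone d f <->
     exists2 E : 'I_m -> {mpoly R[n]},
       forall i, [/\ exists (r : nat) (v : 'I_r.+1 -> 'X_{1..n}),
                       circuit_poly v (y i) (E i),
                     nonneg_mpoly (E i)
                   & {subset msupp (E i) <= y i :: codom (with_origin alpha)}]
     & f = \sum_i E i) /\
  (range y `<=` max_mediated R (with_origin alpha) ->
     (P_cone d f <-> Sigma_cone d f) /\
     (Sigma_cone d f <-> binomial_sos f)) /\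
  (H_simplex R (with_origin alpha) ->
     (P_cone d f <-> Sigma_cone d f) /\
     (Sigma_cone d f <-> binomial_sos f)).
Proof.
have lam_gt0 i j : 0 < lambda i j by apply: interior_comb_gt0 (lambdaP i) j.
have yE i := (lambdaP i).2.
have origin_even j : even_mnm (with_origin alpha j).
  by rewrite /with_origin; case: unlift => //= k; rewrite mnm0E.
have [l] := agiform_decomposition (\sum_i lambda i ord0)
  Delta_dim m_gt0 lam_gt0 yE b_gt0 a_gt0.
rewrite -f_def; set g := f.@[_] => fE.
pose A i := a i * expR (pairing l (y i)).
have A_gt0 i : 0 < A i by rewrite mulr_gt0 ?expR_gt0.
have g_ge0 : P_cone d f -> 0 <= g by move=> [_]; exact.
(* The vertices are exponents of [f]: they differ from the interior points
   [y i], so no cancellation occurs. *)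
have vertex_deg j : (mdeg (with_origin alpha j) <= 2 * d)%N.
  rewrite /with_origin; case: unliftP => [k _|_] /=; last by rewrite mdeg0.
  rewrite -ltnS; apply: leq_trans f_deg; apply: msize_mdeg_lt.
  have alphaE : alpha k = with_origin alpha (lift ord0 k).
    by rewrite /with_origin liftK.
  rewrite mcoeff_msupp f_def mcoeffB mcoeffD mcoeffC.
  rewrite !(big_morph _ (mcoeffD _) (mcoeff0 _ _)).
  have -> : (alpha k == 0%MM) = false.
    apply/negbTE/eqP => ak; have : with_origin alpha (lift ord0 k) =
        with_origin alpha ord0 by rewrite /with_origin liftK unlift_none.
    by move/(vertex_inj Delta_dim).
  rewrite mulr0 add0r [X in _ - X]big1 => [|i _]; last first.
    rewrite mcoeffZ mcoeffX; case: eqVneq => [yk|_]; last by rewrite mulr0.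
    have := yE i; rewrite yk alphaE => yk'.
    have := affine_comb_inj Delta_dim yk' (affine_comb_vertex _ _ _) ord0.
    by move=> lam0; have := lam_gt0 i ord0; rewrite lam0 ltxx.
  rewrite subr0 (bigD1 k) //= mcoeffZ mcoeffX eqxx mulr1 big1 ?addr0.
    by rewrite gt_eqF.
  move=> j' jk; rewrite mcoeffZ mcoeffX; case: eqVneq => [aj|_]; last first.
    by rewrite mulr0.
  have /(vertex_inj Delta_dim)/lift_inj kj : with_origin alpha (lift ord0 j') =
      with_origin alpha (lift ord0 k) by rewrite /with_origin !liftK.
  by rewrite kj eqxx in jk.
have mediated_case : range y `<=` max_mediated R (with_origin alpha) ->
    (P_cone d f <-> Sigma_cone d f) /\ (Sigma_cone d f <-> binomial_sos f).
  move=> y_med.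
  have P_bs : P_cone d f -> binomial_squares d f.
    move=> /g_ge0 g0; rewrite fE; apply: binomial_squaresD.
      (* The constant is itself the square of a monomial. *)
      rewrite -[g]sqr_sqrtr // rmorphXn /=; apply: binomial_squares_sqr.
        by rewrite msuppC; case: ifP.
      by rewrite msizeC; case: (_ != 0).
    apply: binomial_squares_sum => i.
    apply: binomial_squaresZ; first exact: ltW (A_gt0 i).
    by apply: agiform_binomial_squares => //; apply: y_med; exists i.
  have Sigma_P : Sigma_cone d f -> P_cone d f.
    by move=> [qs _ fqs]; split=> //; rewrite fqs; exact: sum_sqr_nonneg.
  have sos_P : binomial_sos f -> P_cone d f.
    by move=> [qs _ fqs]; split=> //; rewrite fqs; exact: sum_sqr_nonneg.
  split; split.
  - by move/P_bs/binomial_squares_Sigma.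
  - exact: Sigma_P.
  - by move/Sigma_P/P_bs/binomial_squares_sos.
  - by move/sos_P/P_bs/binomial_squares_Sigma.
split; last first.
  split=> // H; apply: mediated_case => _ [i _ <-].
  by rewrite H; exists (lambda i).
split=> [/g_ge0 g0|[E E_P fsum]]; last first.
  split=> // x; rewrite fsum (big_morph _ (mevalD x) (meval0 x)).
  by apply: sumr_ge0 => i _; have [_ + _] := E_P i; exact.
exists (fun i => (g / m%:R)%:MP
                 + A i *: agiform l (with_origin alpha) (lambda i) (y i)).
  move=> i; have gm_ge0 : 0 <= g / m%:R by rewrite divr_ge0 ?ler0n.
  have E_circuit := circuit_poly_agiform l Delta_dim alpha_even (y_int i)
    (lam_gt0 i) gm_ge0 (A_gt0 i).
  split; [by exists n, (with_origin alpha) | | exact: msupp_circuit].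
  move=> x; rewrite mevalD mevalC mevalZ addr_ge0 //.
  rewrite (mulr_ge0 (ltW (A_gt0 i))) //.
  exact: agiform_nonneg.
have gE : \sum_(i < m) g / m%:R = g.
  by rewrite sumr_const card_ord -[LHS]mulr_natr divfK // pnatr_eq0 -lt0n.
by rewrite big_split /= -rmorph_sum /= gE {1}fE.
Qed.
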